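(* $b(5)=5^{-5}$.
   Context: For a finite set $X$, $K_X$ is the complete graph on $X$, and a probability mass $\mu$ on $\binom{X}{2}$ is a function from the 2-element subsets of $X$ (edges of $K_X$) to $[0,1]$ with total sum $1$. For a graph $G$ and $m\geq 3$, $\mathcal C_m(G)$ is the set of (unlabeled) copies of the $m$-cycle $C_m$ in $G$. For a subgraph $G\subseteq K_X$, $\mu(G)=\prod_{e\in E(G)}\mu(e)$. Define $b(\mu;m)=\sum_{C\in\mathcal C_m(K_X)}\mu(C)$ (the probability that $m$ independent samples from $\mu$ form an $m$-cycle, up to normalization by ordering), and $b(m)=\sup\{b(\mu;m)\}$, the supremum over all finite sets $X$ and all probability masses $\mu$ on $\binom X2$. *)

(* Defs.v *)
From mathcomp Require Import all_boot all_order all_algebra.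
From mathcomp Require Import all_classical all_reals.

Set Implicit Arguments.
Unset Strict Implicit.
Unset Printing Implicit Defensive.

Import Order.TTheory GRing.Theory Num.Theory.

Local Open Scope ring_scope.

(* Graphs without isolated vertices are represented by their edge sets, of
   type {set {set X}}; a subgraph of K_X that is a copy of an m-cycle is
   determined by its edge set. *)

Definition complete_graph (X : finType) : {set {set X}} :=
  [set e : {set X} | #|e| == 2%N].

(* This is the m-cycle for m >= 3 only; ordS is the successor modulo m. *)
Definition cycle_graph (m : nat) : {set {set 'I_m}} :=
  [set [set i; ordS i] | i : 'I_m].

Definition is_copy (Y X : finType) (H : {set {set Y}}) (C : {set {set X}}) :
    bool :=
  [exists f : {ffun Y -> X},
    injectiveb f && (C == [set f @: (e : {set Y}) | e in H])].

Definition cycle_copies (X : finType) (G : {set {set X}}) (m : nat) :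
    {set {set {set X}}} :=
  [set C : {set {set X}} | (C \subset G) && is_copy (cycle_graph m) C].

(* Only the values of mu on the edges of K_X are relevant, here and below. *)
Definition prob_mass (R : realType) (X : finType) (mu : {set X} -> R) : Prop :=
  (forall e, e \in complete_graph X -> 0 <= mu e <= 1) /\
  \sum_(e in complete_graph X) mu e = 1.

Definition graph_mass (R : realType) (X : finType) (mu : {set X} -> R)
    (G : {set {set X}}) : R :=
  \prod_(e in G) mu e.

Definition b_mass (R : realType) (X : finType) (mu : {set X} -> R) (m : nat) :
    R :=
  \sum_(C in cycle_copies (complete_graph X) m) graph_mass mu C.

(* The supremum in R is 0 by convention on sets that are empty or unbounded
   above, so a nonzero value is a genuine least upper bound. *)
Definition b_sup (R : realType) (m : nat) : R :=
  sup [set r : R | exists (X : finType) (mu : {set X} -> R),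
                     prob_mass mu /\ r = b_mass mu m]%classic.

(* Main.v *)
Require Import Defs.
From mathcomp Require Import all_boot all_order all_algebra.
From mathcomp Require Import all_classical all_reals.
From mathcomp Require Import all_analysis.
From mathcomp Require Import ring lra.

Set Implicit Arguments.
Unset Strict Implicit.
Unset Printing Implicit Defensive.

Import Order.TTheory GRing.Theory Num.Theory.
Import numFieldNormedType.Exports.

Local Open Scope ring_scope.

(* The uniform mass on [C_5] gives the lower bound. For the upper bound, fix [X]
   and let [mu] maximise [B = b(mu; 5)], which exists by compactness. For any set
   [S] of edges, the first-order condition at [mu] gives
     5 B mu(S) <= \sum_C mu(C) |C :&: S|.
   With [S] an edge or a star this yields [mu(e) <= 1/5] and [deg(x) <= 2/5], and
   also that the weighted number of 4-edge paths joining the ends of an edge [e]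
   with [mu(e) > 0] is at least [5 B]. Let [e = uv] have the largest mass [M], and
   let [A], [B'], [C] be the masses of the other edges at [u], of the other edges
   at [v], and of the edges avoiding both. The paths [u x y z v] have total weight
   at most [A B' max_(x, z) \sum_y mu(xy) mu(yz)]. As all masses are at most [M],
   the inner sum is at most [M C / 2] and at most [M^2 + (C/2 - M)^2], and
   with [M + A + B' + C = 1], [M <= 1/5] and [A, B' <= 2/5 - M] this forces the
   weight of the paths to be at most [5^-4]. *)

Implicit Types (X : finType).

(** * Polynomial inequalities in the masses *)

(** Here [M * C <= 4/25 * (M + C) ^+ 2], with equality at [C = 4 * M], and [s * (M + C) <= 1/8] by
    AM-GM; together they give [1/800]. *)
Lemma cap_bound_large_rest (R : realFieldType) (M s C : R) :
  0 <= M -> 0 <= s -> 4 * M <= C -> M + s * 2 + C = 1 ->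
  s ^+ 2 * (M * C / 2) <= 1 / 625.
Proof.
move=> M0 s0 MC e.
have h1 : M * C <= 4/25 * (M + C) ^+ 2.
  have : 0 <= (C - 4 * M) * (4 * C - M) by apply: mulr_ge0; lra.
  lra.
have h2 : s * (M + C) <= 1/8.
  have -> : M + C = 1 - s * 2 by lra.
  have := sqr_ge0 (s - 1/4); lra.
have q0 : 0 <= s * (M + C) by apply: mulr_ge0; lra.
have h3 : (s * (M + C)) ^+ 2 <= (1/8) ^+ 2.
  by apply: lerXn2r; rewrite ?nnegrE //; lra.
have h4 : s ^+ 2 * (M * C) <= s ^+ 2 * (4/25 * (M + C) ^+ 2).
  by apply: ler_wpM2l => //; apply: sqr_ge0.
lra.
Qed.

(** AM-GM on [s], [s], [C], whose sum is [1 - M], leaves a function of [M] alone. *)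
Lemma cap_bound_small_max (R : realFieldType) (M s C : R) :
  0 <= M -> 0 <= s -> 0 <= C -> M <= 13/100 -> M + s * 2 + C = 1 ->
  s ^+ 2 * (M * C / 2) <= 1 / 625.
Proof.
move=> M0 s0 C0 MC e.
have h1 : s ^+ 2 * C <= (1 - M) ^+ 3 / 27.
  have -> : M = 1 - s * 2 - C by lra.
  have h : 0 <= (s - C) ^+ 2 * (8 * s + C) by apply: mulr_ge0; [exact: sqr_ge0 | lra].
  rewrite -subr_ge0.
  have -> : (1 - (1 - s * 2 - C)) ^+ 3 / 27 - s ^+ 2 * C = (s - C) ^+ 2 * (8 * s + C) / 27 by field.
  lra.
(* The left side increases up to [M = 1/4]; [864/10000] is [54/625], exactly what the final bound
   allows. *)
have h2 : M * (1 - M) ^+ 3 <= 864/10000.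
  nra.
have h3 : M * (s ^+ 2 * C) <= M * ((1 - M) ^+ 3 / 27) by apply: ler_wpM2l.
lra.
Qed.

(* With [s + w] fixed the left-hand side decreases in [w] on this range, so the
   worst case is the largest [s], namely [s1 = 2/5 - M] with [w1 = 1/10 - M/2]. *)
Lemma two_bound_large_max (R : realFieldType) (M s w : R) :
  0 <= s -> 0 <= w -> 13/100 <= M -> M <= 1/5 ->
  s <= 2/5 - M -> s + w = (1 - 3 * M) / 2 ->
  s ^+ 2 * (M ^+ 2 + w ^+ 2) <= 1 / 625.
Proof.
move=> s0 w0 lM uM sM e.
pose s1 := 2/5 - M; pose w1 := 1/10 - M/2.
have w1w : w1 <= w by rewrite /w1; lra.
have h1 : s1 ^+ 2 * (M ^+ 2 + w1 ^+ 2) <= 1 / 625.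
  (* Equality holds at [d = 0], the case of the uniform 5-cycle. *)
  pose d := 1/5 - M.
  have d0 : 0 <= d by rewrite /d; lra.
  have d1 : d <= 7/100 by rewrite /d; lra.
  have -> : s1 = 1/5 + d by rewrite /s1 /d; lra.
  have -> : w1 = d / 2 by rewrite /w1 /d; lra.
  have -> : M = 1/5 - d by rewrite /d; lra.
  nra.
(* The values at [(s1, w1)] and [(s, w)] differ by [w - w1] times the gap between these two
   sides. *)
have h2 : (s * w + s1 * w1) * (s - w1) <= M ^+ 2 * (s1 + s).
  (* AM-GM: [w] and [s - w1] have sum [s1]. *)
  have h : w * (s - w1) <= (s1 / 2) ^+ 2.
    have -> : s = s1 + w1 - w by rewrite /s1 /w1; lra.
    have := sqr_ge0 (w - s1/2); lra.
  have [sw|sw] := lerP s w1.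
    have : 0 <= (s * w + s1 * w1) * (w1 - s).
      by apply: mulr_ge0; [apply: addr_ge0; apply: mulr_ge0; rewrite /s1 /w1|]; lra.
    have : 0 <= M ^+ 2 * (s1 + s) by apply: mulr_ge0; [exact: sqr_ge0 | rewrite /s1; lra].
    lra.
  have h4 : s * (w * (s - w1)) <= s * (s1 / 2) ^+ 2 by apply: ler_wpM2l.
  have h5 : s1 * w1 * (s - w1) <= s1 * w1 * (s1 - w1).
    by apply: ler_wpM2l; [apply: mulr_ge0; rewrite /s1 /w1|rewrite /s1]; lra.
  have h6 : w1 * (s1 - w1) <= M ^+ 2 by rewrite /w1 /s1; nra.
  have h7 : (s1 / 2) ^+ 2 + w1 * (s1 - w1) <= 2 * M ^+ 2 by rewrite /w1 /s1; nra.
  (* Writing [s1 = s + (s1 - s)] in the coefficient of [w1 * (s1 - w1)] splits the bound into [h8]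
     and [h9], whose right-hand sides add up to [M ^+ 2 * (s1 + s)]. *)
  have h8 : s * ((s1 / 2) ^+ 2 + w1 * (s1 - w1)) <= s * (2 * M ^+ 2) by apply: ler_wpM2l.
  have h9 : (s1 - s) * (w1 * (s1 - w1)) <= (s1 - s) * M ^+ 2.
    by apply: ler_wpM2l => //; rewrite /s1; lra.
  lra.
have h3 : s1 ^+ 2 * (M ^+ 2 + w1 ^+ 2) - s ^+ 2 * (M ^+ 2 + w ^+ 2) =
   (w - w1) * (M ^+ 2 * (s1 + s) - (s * w + s1 * w1) * (s - w1)).
  have -> : w = s1 + w1 - s by rewrite /s1 /w1; lra.
  ring.
have : 0 <= (w - w1) * (M ^+ 2 * (s1 + s) - (s * w + s1 * w1) * (s - w1)).
  by apply: mulr_ge0; lra.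
lra.
Qed.

(** * Edges and copies of the 5-cycle *)

Definition edge_weight (R : realType) X (mu : {set X} -> R) (x y : X) : R :=
  mu [set x; y].

Lemma edge_weightC (R : realType) X (mu : {set X} -> R) x y :
  edge_weight mu x y = edge_weight mu y x.
Proof. by rewrite /edge_weight finset.setUC. Qed.

Definition cycle5_edges X (x0 x1 x2 x3 x4 : X) : seq {set X} :=
  [:: [set x0; x1]; [set x1; x2]; [set x2; x3]; [set x3; x4]; [set x4; x0]].

Lemma eq_edge X (a b c d : X) :
  ([set a; b] == [set c; d]) = (a == c) && (b == d) || (a == d) && (b == c).
Proof.
apply/eqP/orP => [e|[/andP[/eqP-> /eqP->] //|/andP[/eqP-> /eqP->]]]; last exact: finset.setUC.
have : b \in [set c; d] by rewrite -e set22.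
have : c \in [set a; b] by rewrite e set21.
have : d \in [set a; b] by rewrite e set22.
have : a \in [set c; d] by rewrite -e set21.
by move=> /set2P[]? /set2P[]? /set2P[]? /set2P[]?; subst;
  first [left; rewrite !eqxx | right; rewrite !eqxx].
Qed.

Lemma uniq_cycle5_edges X (x0 x1 x2 x3 x4 : X) :
  uniq [:: x0; x1; x2; x3; x4] -> uniq (cycle5_edges x0 x1 x2 x3 x4).
Proof.
rewrite /= !inE !negb_or -!andbA.
  move=> /and5P[h01 h02 h03 h04 /and5P[h12 h13 h14 h23 /and3P[h24 h34 _]]].
rewrite !eq_edge ?[x1 == x0]eq_sym ?[x2 == x0]eq_sym ?[x3 == x0]eq_sym ?[x4 == x0]eq_sym.
rewrite ?[x2 == x1]eq_sym ?[x3 == x1]eq_sym ?[x4 == x1]eq_sym ?[x3 == x2]eq_sym ?[x4 == x2]eq_sym.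
rewrite ?[x4 == x3]eq_sym.
rewrite ?(negbTE h01) ?(negbTE h02) ?(negbTE h03) ?(negbTE h04) ?(negbTE h12) ?(negbTE h13).
by rewrite ?(negbTE h14) ?(negbTE h23) ?(negbTE h24) ?(negbTE h34) ?andbF.
Qed.

Lemma cycle5_copyP X (C : {set {set X}}) :
  is_copy (cycle_graph 5) C ->
  exists x0 x1 x2 x3 x4 : X, uniq [:: x0; x1; x2; x3; x4] /\
    C = [set e in cycle5_edges x0 x1 x2 x3 x4].
Proof.
case/existsP => f /andP[/injectiveP f_inj /eqP ->].
pose o k : 'I_5 := inord k.
exists (f (o 0%N)), (f (o 1%N)), (f (o 2%N)), (f (o 3%N)), (f (o 4%N)); split.
  rewrite (map_inj_uniq f_inj [:: o 0%N; o 1%N; o 2%N; o 3%N; o 4%N]).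
  by rewrite -(map_inj_uniq val_inj) /= !inordK.
rewrite /cycle_graph -imset_comp; apply/setP => e.
have fE (i : 'I_5) : f @: [set i; ordS i] = [set f i; f (ordS i)].
  by rewrite imsetU1 imset_set1.
have S k l : (k < 5)%N -> l = (k.+1 %% 5)%N -> ordS (o k) = o l.
  by move=> k5 ->; apply/val_inj; rewrite /= !inordK // ltn_mod.
apply/imsetP/idP => [[i _ ->] /=|]; last first.
  rewrite !inE => /or4P[|||/orP[]] /eqP->;
   [exists (o 0%N)|exists (o 1%N)|exists (o 2%N)|exists (o 3%N)|exists (o 4%N)] => //=;
   rewrite fE; congr [set _; f _]; symmetry; exact: S.
rewrite fE !inE.
have -> : i = o i by apply/val_inj; rewrite /= inordK.
case: i => [[|[|[|[|[|//]]]]] Hi] /=.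
- by rewrite (@S _ 1%N) // eqxx.
- by rewrite (@S _ 2%N) // eqxx ?orbT.
- by rewrite (@S _ 3%N) // eqxx ?orbT.
- by rewrite (@S _ 4%N) // eqxx ?orbT.
- by rewrite (@S _ 0%N) // eqxx ?orbT.
Qed.

Lemma card_cycle5_copy X (C : {set {set X}}) :
  is_copy (cycle_graph 5) C -> #|C| = 5%N.
Proof.
case/cycle5_copyP => x0 [x1 [x2 [x3 [x4 [/uniq_cycle5_edges u ->]]]]].
by rewrite cardsE; exact: (card_uniqP u).
Qed.

(** A rotation of the vertex list makes the given edge the closing one; if it is then traversed the
    wrong way, the list is reversed. *)
Lemma cycle5_copy_through X (C : {set {set X}}) (u v : X) :
  is_copy (cycle_graph 5) C -> [set u; v] \in C ->
  exists x y z : X, uniq [:: u; x; y; z; v] /\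
    C = [set e in cycle5_edges u x y z v].
Proof.
move=> /cycle5_copyP[x0 [x1 [x2 [x3 [x4 [un ->]]]]]].
have rotE k (s : seq {set X}) : [set e in s] = [set e in rot k s].
  by apply/setP => e; rewrite !inE mem_rot.
have revE (s : seq {set X}) : [set e in s] = [set e in rev s].
  by apply/setP => e; rewrite !inE mem_rev.
have last_edge (y0 y1 y2 y3 y4 : X) : uniq [:: y0; y1; y2; y3; y4] ->
    [set u; v] == [set y4; y0] ->
    exists x y z : X, uniq [:: u; x; y; z; v] /\
      [set e in cycle5_edges y0 y1 y2 y3 y4] = [set e in cycle5_edges u x y z v].
  move=> uy; rewrite eq_edge => /orP[]/andP[/eqP-> /eqP->]; last by exists y1, y2, y3.
  exists y3, y2, y1; split; first by rewrite -rev_uniq.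
  rewrite (_ : cycle5_edges y4 y3 y2 y1 y0 = rot 1 (rev (cycle5_edges y0 y1 y2 y3 y4))).
    by rewrite -rotE -revE.
  by rewrite /cycle5_edges /rev /= /rot /=; congr [:: _; _; _; _; _]; exact: finset.setUC.
have rot_un k : uniq (rot k [:: x0; x1; x2; x3; x4]) by rewrite rot_uniq.
rewrite 6!inE => /or4P[|||/orP[]]; last exact: last_edge.
- by rewrite (rotE 1%N); apply: last_edge; exact: (rot_un 1%N).
- by rewrite (rotE 2%N); apply: last_edge; exact: (rot_un 2%N).
- by rewrite (rotE 3%N); apply: last_edge; exact: (rot_un 3%N).
- by rewrite (rotE 4%N); apply: last_edge; exact: (rot_un 4%N).
Qed.

(** A vertex on the cycle lies only on the edge to its successor and the edge from its
    predecessor. *)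
Lemma card_cycle5_copy_star X (C : {set {set X}}) (w : X) :
  is_copy (cycle_graph 5) C -> (#|[set e in C | w \in e]| <= 2)%N.
Proof.
case/existsP => f /andP[/injectiveP f_inj /eqP ->].
pose g (i : 'I_5) := f @: [set i; ordS i].
have gE (i : 'I_5) : g i = [set f i; f (ordS i)] by rewrite /g imsetU1 imset_set1.
have -> : [set f @: (e : {set 'I_5}) | e in cycle_graph 5] = [set g i | i : 'I_5].
  by rewrite /cycle_graph -imset_comp.
have [[i ->]|nw] := pselect (exists i, w = f i); last first.
  rewrite (_ : [set e in _ | _] = finset.set0) ?cards0 //; apply/setP => e; rewrite !inE.
  apply/negP => /andP[/imsetP[i _ ->]]; rewrite gE => /set2P[] wE; apply: nw;
  by eexists; exact: wE.
apply: (@leq_trans #|[set g i; g (ord_pred i)]|); last by rewrite cards2 ltnS leq_b1.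
apply/subset_leq_card/fintype.subsetP => e; rewrite !inE => /andP[/imsetP[j _ /= ->]].
rewrite {1}gE => /set2P[] /f_inj -> ; first by rewrite eqxx.
by rewrite ordSK eqxx orbT.
Qed.

(** * Sums over images and over edges avoiding given vertices *)

(** Every fibre of [h] over its image is nonempty. This lets cycles be counted through vertex tuples
    without proving the parametrisation injective. *)
Lemma sum_imset_le (R : numDomainType) (I J : finType) (A : {pred I}) (h : I -> J)
    (F : J -> R) : (forall j, j \in h @: A -> 0 <= F j) ->
  \sum_(j in h @: A) F j <= \sum_(i in A) F (h i).
Proof.
move=> F0; rewrite (partition_big_imset h) /=; apply: ler_sum => j jA.
case/imsetP: (jA) => i iA ->; rewrite (bigD1 i) /= ?iA ?eqxx // lerDl.
by apply: sumr_ge0 => k /andP[/andP[kA _] _]; apply: F0; exact: imset_f.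
Qed.

(** The deleted vertices form a list so that they can be peeled off one at a time, each taking its
    remaining star with it and no edge being counted twice. *)
Definition avoiding_mass (R : realType) X (mu : {set X} -> R) (D : seq X) : R :=
  \sum_(e in complete_graph X | all (fun d => d \notin e) D) mu e.

Lemma avoiding_mass_cons (R : realType) X (mu : {set X} -> R) (D : seq X) (w : X) :
  w \notin D -> avoiding_mass mu D =
    \sum_(y | y \notin w :: D) edge_weight mu w y + avoiding_mass mu (w :: D).
Proof.
move=> wD; rewrite /avoiding_mass (bigID (fun e : {set X} => w \in e)) /=; congr (_ + _); last first.
  by apply: eq_bigl => e; rewrite -andbA; congr andb; rewrite andbC.
rewrite -(@big_imset _ _ _ _ _ (fun y => [set w; y]) [pred y | y \notin w :: D] mu) /=; last first.
  move=> y z _ _ /eqP; rewrite eq_edge eqxx => /orP[/eqP//|/andP[/eqP-> /eqP->]//].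
apply: eq_bigl => e; apply/idP/imsetP => [|[y]].
  rewrite inE => /andP[/andP[/cards2P[a [b [ab ->]]] /allP aD]].
  have h c : (c \in [set a; b]) -> c \notin D by apply: contraL => /aD.
  case/set2P => ->; [exists b => //|exists a; last by rewrite finset.setUC].
    by rewrite !inE negb_or eq_sym ab h // set22.
  by rewrite !inE negb_or ab h // set21.
rewrite !inE negb_or => /andP[yw yD] ->; rewrite cards2 [w == y]eq_sym yw set21 !andbT /=.
by apply/allP => d dD; rewrite !inE negb_or; apply/andP; split;
  [apply: contraNN wD|apply: contraNN yD] => /eqP <-.
Qed.

(** * Existence of a maximiser *)

(** Masses are encoded as row vectors indexed by all subsets of [X]; those of total 1 form a closed
    part of a compact cube, on which [b_mass] is continuous. *)
Lemma exists_max_b_mass (R : realType) X (mu : {set X} -> R) m : prob_mass mu ->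
  exists2 mu0 : {set X} -> R, prob_mass mu0 &
    forall nu : {set X} -> R, prob_mass nu -> b_mass nu m <= b_mass mu0 m.
Proof.
move=> mu_prob.
pose n := #|{set X}|.
pose fn (v : 'rV[R]_n) (e : {set X}) : R := v ord0 (enum_rank e).
pose tot v := \sum_(e in complete_graph X) fn v e.
pose box := [set v : 'rV[R]_n | forall i, (`[0, 1]%classic : set R) (v ord0 i)]%classic.
pose A := (box `&` tot @^-1` [set 1])%classic.
have fn_cont e : continuous (fn^~ e) by move=> v; exact: coord_continuous.
have tot_cont : continuous tot.
  by apply: continuous_big => //; exact: add_continuous.
have A_compact : compact A.
  apply: compact_closedI.
    by apply: (@rV_compact R n (fun=> `[0, 1]%classic)) => i; exact: segment_compact.
  move/continuous_closedP: tot_cont; apply.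
  exact: closed_eq.
(* A mass is unconstrained off the edges, so 0 is put there to land in the cube. *)
pose vec (nu : {set X} -> R) : 'rV[R]_n :=
  \row_i (if enum_val i \in complete_graph X then nu (enum_val i) else 0).
have fn_vec nu e : e \in complete_graph X -> fn (vec nu) e = nu e.
  by move=> eK; rewrite /fn mxE enum_rankK eK.
have vec_A nu : prob_mass nu -> A (vec nu).
  move=> [nu01 nu1]; split => [i|] /=.
    by rewrite in_itv /= mxE; case: ifPn => [/nu01 //|_]; rewrite lexx ler01.
  by rewrite /tot -[RHS]nu1; apply: eq_bigr => e; exact: fn_vec.
have A_prob v : A v -> prob_mass (fn v).
  move=> [v01 v1]; split => // e _.
  by have := v01 (enum_rank e); rewrite /= in_itv.
have b_vec nu : b_mass (fn (vec nu)) m = b_mass nu m.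
  apply: eq_bigr => C; rewrite inE => /andP[/fintype.subsetP CK _].
  by apply: eq_bigr => e /CK; exact: fn_vec.
have b_cont : continuous (fun v => b_mass (fn v) m).
  apply: continuous_big => [|C _]; first exact: add_continuous.
  by apply: continuous_big => //; exact: mul_continuous.
have [||v vA vmax] := @EVT_max_rV R n (fun v => b_mass (fn v) m) A _ A_compact.
- by exists (vec mu); exact: vec_A.
- exact: continuous_subspaceT.
exists (fn v) => [|nu nu_prob]; first by apply: A_prob; rewrite inE in vA.
by rewrite -b_vec; apply: vmax; rewrite inE; exact: vec_A.
Qed.

(** * The first-order condition at a maximiser *)

Lemma bernoulli_le (R : realDomainType) (s : R) (k : nat) :
  0 <= s <= 1 -> 1 - s * k%:R <= (1 - s) ^+ k.
Proof.
move=> /andP[s0 s1]; elim: k => [|k IH]; first by rewrite mulr0 subr0.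
have := ler_wpM2l (_ : 0 <= 1 - s) IH; rewrite exprS -natr1 => /(_ ltac:(lra)).
have : 0 <= s * s * k%:R by rewrite !mulr_ge0.
lra.
Qed.

Lemma graph_mass_ge0 (R : realType) X (mu : {set X} -> R) (C : {set {set X}}) m :
  (forall e, e \in complete_graph X -> 0 <= mu e) ->
  C \in cycle_copies (complete_graph X) m -> 0 <= graph_mass mu C.
Proof.
move=> mu0; rewrite inE => /andP[/fintype.subsetP CK _].
by apply: prodr_ge0 => e /CK /mu0.
Qed.

(** A 5-cycle has five edges, so dividing [nu] by its total divides [b_mass] by the fifth power of
    that total. *)
Lemma b_mass5_homogeneous (R : realType) X (nu : {set X} -> R) (B : R) :
  (forall mu : {set X} -> R, prob_mass mu -> b_mass mu 5 <= B) ->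
  (forall e, e \in complete_graph X -> 0 <= nu e) ->
  0 < \sum_(e in complete_graph X) nu e ->
  b_mass nu 5 <= B * (\sum_(e in complete_graph X) nu e) ^+ 5.
Proof.
move=> maxB nu0; set N := \sum_(_ in _) _ => N0.
have sumE : \sum_(e in complete_graph X) nu e / N = 1.
  by rewrite -mulr_suml divff // gt_eqF.
have prob : prob_mass (fun e => nu e / N).
  split=> // e eK; apply/andP; split; first by apply: divr_ge0; [exact: nu0 | exact: ltW].
  rewrite ler_pdivrMr // mul1r.
  by rewrite /N (bigD1 e) //= lerDl sumr_ge0 // => f /andP[/nu0].
rewrite -ler_pdivrMr ?exprn_gt0 //; apply: le_trans (maxB _ prob).
rewrite /b_mass mulr_suml; apply: ler_sum => C.
rewrite inE => /andP[_ /card_cycle5_copy C5].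
by rewrite /graph_mass big_split /= prodr_const C5 exprVn.
Qed.

(* Shrinking the mass on [S] by a factor [1 - s] and renormalising cannot
   increase the maximum; this is the first-order condition as [s] tends to 0. *)
Lemma max_b_mass5_first_order (R : realType) X (mu : {set X} -> R) (S : {set {set X}}) :
  prob_mass mu ->
  (forall nu : {set X} -> R, prob_mass nu -> b_mass nu 5 <= b_mass mu 5) ->
  5 * b_mass mu 5 * \sum_(e in complete_graph X | e \in S) mu e <=
  \sum_(C in cycle_copies (complete_graph X) 5) graph_mass mu C * #|C :&: S|%:R.
Proof.
move=> [mu01 mu1] maxB; set B := b_mass mu 5; set p := \sum_(_ in _ | _) _.
set L := \sum_(C in _) _.
have mu0 e : e \in complete_graph X -> 0 <= mu e by move/mu01/andP => [].
have p0 : 0 <= p by apply: sumr_ge0 => e /andP[/mu0].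
have p1 : p <= 1.
  rewrite /p -mu1 [leRHS](bigID (mem S)) /= lerDl; apply: sumr_ge0 => e /andP[/mu0 //].
have B0 : 0 <= B by apply: sumr_ge0 => C; exact: graph_mass_ge0.
(* The error [10 * s * B] comes from the quadratic term of [(1 - s * p) ^+ 5], using [p <= 1]. *)
have step (s : R) : 0 < s -> s < 1 -> 5 * B * p - L <= 10 * s * B.
  move=> s0 s1.
  pose nu e := mu e * (if e \in S then 1 - s else 1).
  have nuE : \sum_(e in complete_graph X) nu e = 1 - s * p.
    rewrite -mu1 /p (bigID (mem S)) /= [in RHS](bigID (mem S)) /= mulr_sumr.
    rewrite addrAC -sumrB; congr (_ + _); apply: eq_bigr => e /andP[_ eS].
      by rewrite /nu eS; ring.
    by rewrite /nu (negbTE eS) mulr1.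
  have sp : 0 <= s * p <= s.
    by apply/andP; split; [apply: mulr_ge0 | apply: ler_piMr] => //; exact: ltW.
  have nu0 e : e \in complete_graph X -> 0 <= nu e.
    by move=> /mu0 ?; rewrite /nu mulr_ge0 //; case: ifP => _; lra.
  have := b_mass5_homogeneous maxB nu0; rewrite nuE -/B => /(_ ltac:(lra)) le_B.
  have ge_B : B - s * L <= b_mass nu 5.
    rewrite /B /L /b_mass mulr_sumr -sumrB; apply: ler_sum => C CC.
    have -> : graph_mass nu C = graph_mass mu C * (1 - s) ^+ #|C :&: S|.
      rewrite /graph_mass /nu big_split /= -big_mkcondr /=; congr (_ * _).
      rewrite -prodr_const; apply: eq_bigl => e; by rewrite !inE.
    have s01 : 0 <= s <= 1 by rewrite !ltW.
    have := ler_wpM2l (graph_mass_ge0 mu0 CC) (bernoulli_le #|C :&: S| s01).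
    by apply: le_trans; rewrite mulrBr mulr1 mulrCA.
  have {le_B ge_B} le_B := le_trans ge_B le_B.
  clearbody B L p; clear nu nuE nu0.
  have pow5 : (1 - s * p) ^+ 5 <= 1 - 5 * (s * p) + 10 * (s * p) ^+ 2.
    move: (s * p) sp => t /andP[t0 ts].
    have : 0 <= t ^+ 3 * (10 - 5 * t + t ^+ 2).
      by apply: mulr_ge0; [exact: exprn_ge0 | have := sqr_ge0 t; lra].
    lra.
  have := ler_wpM2l B0 pow5 => {}pow5.
  have spsq : B * (s * p) ^+ 2 <= B * (s * s).
    apply: ler_wpM2l => //; rewrite expr2; apply: ler_pM; lra.
  have : s * (5 * B * p - L) <= s * (10 * s * B) by lra.
  by rewrite ler_pM2l.
rewrite -subr_le0 leNgt; apply/negP => d0.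
set d := _ - L in step d0.
have D0 : 0 < d + 10 * B + 1 by lra.
(* This [s] lies strictly between 0 and 1 and satisfies [10 * s * B < d], against [step]. *)
have := step (d / (d + 10 * B + 1)) (divr_gt0 d0 D0).
rewrite ltr_pdivrMr // => /(_ ltac:(lra)).
rewrite (_ : 10 * (d / (d + 10 * B + 1)) * B = (10 * d * B) / (d + 10 * B + 1)); last by ring.
rewrite ler_pdivlMr //.
have : 0 < d * d by rewrite mulr_gt0.
lra.
Qed.

(** * Bounds on the weight of 4-edge paths *)

(** AM-GM replaces [A] and [B] by their mean [s]. The first bound on [Q] settles large [C] and small
    [M]; otherwise the second is used with [w = C / 2 - M], nonnegative since [C >= 1/5 + M]. *)
Lemma path_product_le (R : realFieldType) (M A B Q : R) :
  0 <= M <= 1 / 5 -> 0 <= A <= 2 / 5 - M -> 0 <= B <= 2 / 5 - M ->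
  Q <= M * (1 - M - A - B) / 2 ->
  Q <= M ^+ 2 + ((1 - M - A - B) / 2 - M) ^+ 2 ->
  A * B * Q <= 1 / 625.
Proof.
move=> /andP[M0 M5] /andP[A0 A5] /andP[B0 B5] Q1 Q2.
pose s := (A + B) / 2; pose C := 1 - M - A - B.
have s0 : 0 <= s by rewrite /s; lra.
have C0 : 0 <= C by rewrite /C; lra.
have MsC : M + s * 2 + C = 1 by rewrite /s /C; lra.
have ABs : A * B <= s ^+ 2 by rewrite /s; have := sqr_ge0 (A - B); lra.
have bound (K : R) : 0 <= K -> Q <= K -> s ^+ 2 * K <= 1 / 625 -> A * B * Q <= 1 / 625.
  move=> K0 QK; apply: le_trans; apply: (@le_trans _ _ (A * B * K)).
    by apply: ler_wpM2l => //; exact: mulr_ge0.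
  exact: ler_wpM2r.
have bound1 : s ^+ 2 * (M * C / 2) <= 1 / 625 -> A * B * Q <= 1 / 625.
  by apply: bound => //; apply: divr_ge0 => //; exact: mulr_ge0.
have [CM|CM] := lerP (4 * M) C; first exact: bound1 (cap_bound_large_rest M0 s0 CM MsC).
have [M13|M13] := lerP M (13 / 100); first exact: bound1 (cap_bound_small_max M0 s0 C0 M13 MsC).
apply: (bound (M ^+ 2 + (C / 2 - M) ^+ 2)) => //.
  by apply: addr_ge0; exact: sqr_ge0.
by apply: two_bound_large_max; rewrite /s /C; lra.
Qed.

(** Termwise, [s i * t i] is at most [M * s i] and [M * t i], hence at most their mean. *)
Lemma sum_mul_le_cap (R : realFieldType) (I : finType) (P : pred I) (s t : I -> R) (M C : R) :
  (forall i, P i -> 0 <= s i <= M) -> (forall i, P i -> 0 <= t i <= M) ->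
  0 <= M -> \sum_(i | P i) (s i + t i) <= C ->
  \sum_(i | P i) s i * t i <= M * C / 2.
Proof.
move=> sM tM M0 sumC; apply: le_trans (_ : \sum_(i | P i) M * (s i + t i) / 2 <= _).
  apply: ler_sum => i Pi.
  have /andP[s0 s1] := sM i Pi; have /andP[t0 t1] := tM i Pi.
  have := ler_wpM2l s0 t1; have := ler_wpM2r t0 s1; lra.
rewrite -mulr_suml -mulr_sumr; apply: ler_wpM2r; [lra | exact: ler_wpM2l].
Qed.

(* By AM-GM it suffices to bound the sum of squares of the means [h]: if no [h]
   exceeds half of their total, that total times the largest [h] is enough;
   otherwise one [h] dominates and convexity pushes it up to [M]. *)
Lemma sum_mul_le_two (R : realFieldType) (I : finType) (P : pred I) (s t : I -> R) (M C : R) :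
  (forall i, P i -> 0 <= s i <= M) -> (forall i, P i -> 0 <= t i <= M) ->
  \sum_(i | P i) (s i + t i) <= C ->
  \sum_(i | P i) s i * t i <= M ^+ 2 + (C / 2 - M) ^+ 2.
Proof.
move=> sM tM sumC; pose h i := (s i + t i) / 2; pose c := C / 2.
have hM i : P i -> 0 <= h i <= M.
  by move=> Pi; have := sM i Pi; have := tM i Pi; rewrite /h; lra.
have sumh : \sum_(i | P i) h i <= c by rewrite -mulr_suml /c; lra.
have h0 (J : pred I) : 0 <= \sum_(i | P i && J i) h i.
  by apply: sumr_ge0 => i /andP[/hM /andP[]].
have c0 : 0 <= c by apply: le_trans sumh; apply: sumr_ge0 => i /hM /andP[].
have amgm : \sum_(i | P i) s i * t i <= \sum_(i | P i) h i ^+ 2.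
  by apply: ler_sum => i _; rewrite /h; have := sqr_ge0 (s i - t i); lra.
apply: le_trans amgm _.
have [[k Pk hk]|small] := pselect (exists2 k, P k & c / 2 < h k); last first.
  apply: (@le_trans _ _ (c / 2 * \sum_(i | P i) h i)).
    rewrite mulr_sumr; apply: ler_sum => i Pi; rewrite expr2; apply: ler_wpM2r.
      by have /andP[] := hM i Pi.
    by rewrite leNgt; apply/negP => hi; apply: small; exists i.
  (* The bound to reach exceeds [c ^+ 2 / 2] by [(c - 2 * M) ^+ 2 / 2]. *)
  apply: (@le_trans _ _ (c / 2 * c)); first by apply: ler_wpM2l => //; lra.
  by rewrite -/c; have := sqr_ge0 (c - 2 * M); lra.
have /andP[k0 kM] := hM k Pk.
have rest : \sum_(i | P i && (i != k)) h i <= c - h k.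
  by move: sumh; rewrite (bigD1 k) //=; lra.
apply: (@le_trans _ _ (h k ^+ 2 + (c - h k) ^+ 2)).
  rewrite (bigD1 k) //= lerD2l [leRHS]expr2.
  apply: (@le_trans _ _ ((c - h k) * \sum_(i | P i && (i != k)) h i)); last first.
    by apply: ler_wpM2l => //; apply: le_trans rest.
  rewrite mulr_sumr; apply: ler_sum => i Pik; rewrite expr2.
  case/andP: (Pik) => Pi _; have /andP[i0 _] := hM i Pi.
  apply: ler_wpM2r => //; apply: le_trans rest.
  rewrite (bigD1 i) //= lerDl; apply: sumr_ge0 => j /andP[/andP[/hM /andP[//]]].
(* Twice this product is the increase when [h k] is raised to [M]; the second factor is nonnegative
   because [h k > c / 2]. *)
have : 0 <= (M - h k) * (M + h k - c) by apply: mulr_ge0; lra.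
rewrite -/c; lra.
Qed.

(** Removing the edge from a 5-cycle leaves a path [u x y z v]. The pair [p = (x, z)] is summed
    outside, so that the sum over the middle vertex [y] can be bounded on its own. *)
Lemma sum_mass_through_le (R : realType) X (mu : {set X} -> R) (u v : X) :
  (forall e, e \in complete_graph X -> 0 <= mu e) ->
  \sum_(C in cycle_copies (complete_graph X) 5 | [set u; v] \in C) graph_mass mu C <=
  edge_weight mu u v *
  \sum_(p : X * X) \sum_(y | uniq [:: u; p.1; y; p.2; v])
    edge_weight mu u p.1 * edge_weight mu v p.2 *
    (edge_weight mu p.1 y * edge_weight mu p.2 y).
Proof.
move=> mu0.
pose T := [pred t : X * X * X | uniq [:: u; t.1.1; t.2; t.1.2; v]].
pose g (t : X * X * X) := [set e in cycle5_edges u t.1.1 t.2 t.1.2 v].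
have edge_ge0 a b : a != b -> 0 <= mu [set a; b].
  by move=> ab; apply: mu0; rewrite inE cards2 ab.
have gE t : t \in T -> graph_mass mu (g t) = edge_weight mu u v *
    (edge_weight mu u t.1.1 * edge_weight mu v t.1.2 *
     (edge_weight mu t.1.1 t.2 * edge_weight mu t.1.2 t.2)).
  move=> /uniq_cycle5_edges un; rewrite /graph_mass /g.
  under eq_bigl do rewrite inE.
  rewrite -(big_uniq _ un) /cycle5_edges !big_cons big_nil /edge_weight.
  rewrite [[set v; t.1.2]]finset.setUC [[set t.1.2; t.2]]finset.setUC [[set u; v]]finset.setUC.
  by rewrite /=; ring.
have g_ge0 C : C \in g @: T -> 0 <= graph_mass mu C.
  case/imsetP => t; rewrite inE => un ->.
  apply: prodr_ge0 => e; rewrite inE.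
  move: un; rewrite /= !inE !negb_or -!andbA.
  move=> /and5P[h01 h02 h03 h04 /and5P[h12 h13 h14 h23 /and3P[h24 h34 _]]].
  by move=> /or4P[|||/orP[]] /eqP ->; apply: edge_ge0 => //; rewrite eq_sym.
apply: (@le_trans _ _ (\sum_(C in g @: T) graph_mass mu C)).
  rewrite [leRHS](bigID (fun C =>
    (C \in cycle_copies (complete_graph X) 5) && ([set u; v] \in C))) /=.
  rewrite [X in X <= _](_ : _ = \sum_(C in g @: T |
    (C \in cycle_copies (complete_graph X) 5) && ([set u; v] \in C)) graph_mass mu C).
    by rewrite lerDl; apply: sumr_ge0 => C /andP[/g_ge0].
  apply: eq_bigl => C; symmetry; apply: andb_idl => /andP[].
  rewrite inE => /andP[_ copy] uvC.
  have [x [y [z [un ->]]]] := cycle5_copy_through copy uvC.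
  by apply/imsetP; exists (x, z, y).
apply: le_trans (sum_imset_le g_ge0) _.
by rewrite (eq_bigr _ gE) -mulr_sumr pair_big_dep /=.
Qed.

(** Two splittings of the total mass at [u] share the part avoiding [u], which cancels. *)
Lemma star_mass_eq (R : realType) X (mu : {set X} -> R) (u v : X) : u != v ->
  \sum_(e in complete_graph X | u \in e) mu e =
  edge_weight mu u v + \sum_(x | x \notin [:: v; u]) edge_weight mu u x.
Proof.
move=> uv; have := avoiding_mass_cons mu (isT : u \notin [::]).
rewrite /avoiding_mass /= [LHS](bigID (fun e : {set X} => u \in e)) /=.
under eq_bigl do rewrite andbT.
under [X in _ + X = _]eq_bigl do rewrite andbT.
under [X in _ = _ + X]eq_bigl do rewrite andbT.
move/addIr ->; rewrite (bigD1 v) /=; last by rewrite !inE eq_sym.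
by congr (_ + _); apply: eq_bigl => x; rewrite !inE negb_or andbC.
Qed.

(** Deleting [u], [v], [x], [z] in turn removes disjoint sets of edges; the edge [xz] and the edges
    avoiding all four are dropped. This bounds the sum of [s + t] in the estimates of the inner
    sum. *)
Lemma path_mass_le (R : realType) X (mu : {set X} -> R) (u v x z : X) :
  prob_mass mu -> uniq [:: z; x; v; u] ->
  edge_weight mu u v + \sum_(y | y \notin [:: v; u]) edge_weight mu u y +
  \sum_(y | y \notin [:: v; u]) edge_weight mu v y +
  \sum_(y | y \notin [:: z; x; v; u]) (edge_weight mu x y + edge_weight mu z y) <= 1.
Proof.
move=> [mu01 mu1] /=; rewrite andbT => /and3P[zD xD vD].
have mu0 e : e \in complete_graph X -> 0 <= mu e by move/mu01/andP => [].
have uv : u != v by move: vD; rewrite inE eq_sym.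
have E0 : avoiding_mass mu [::] = 1.
  by rewrite -mu1; apply: eq_bigl => e; rewrite andbT.
have E1 := avoiding_mass_cons mu (isT : u \notin [::]).
have E2 := avoiding_mass_cons mu vD.
have E3 := avoiding_mass_cons mu xD.
have E4 := avoiding_mass_cons mu zD.
have E5 : 0 <= avoiding_mass mu [:: z; x; v; u].
  by apply: sumr_ge0 => e /andP[/mu0].
have E6 : \sum_(y | y \notin [:: u]) edge_weight mu u y =
    edge_weight mu u v + \sum_(y | y \notin [:: v; u]) edge_weight mu u y.
  rewrite (bigD1 v) /=; last by rewrite !inE eq_sym.
  by congr (_ + _); apply: eq_bigl => y; rewrite !inE negb_or andbC.
have E7 : \sum_(y | y \notin [:: z; x; v; u]) edge_weight mu x y <=
    \sum_(y | y \notin [:: x; v; u]) edge_weight mu x y.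
  rewrite [leRHS](bigD1 z) //=; apply: ler_wpDl.
    apply: mu0; rewrite inE cards2; move: zD; rewrite !inE !negb_or => /andP[zx _].
    by rewrite [x == z]eq_sym zx.
  by rewrite le_eqVlt (eq_bigl (fun y => (y \notin [:: x; v; u]) && (y != z))) ?eqxx // => y;
    rewrite !inE !negb_or andbC.
rewrite big_split /=; move: E0 E1 E2 E3 E4 E5 E6 E7.
move: (avoiding_mass _ _) (avoiding_mass _ _) (avoiding_mass _ _) (avoiding_mass _ _) (avoiding_mass _ _).
move: (\sum_(_ | _) _) (\sum_(_ | _) _) (\sum_(_ | _) _) (\sum_(_ | _) _) (\sum_(_ | _) _) (\sum_(_ | _) _).
move: (edge_weight _ _ _) => *; lra.
Qed.

(** * The upper bound *)

Lemma b_mass5_le (R : realType) X (mu : {set X} -> R) :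
  prob_mass mu -> b_mass mu 5 <= 5 ^- 5.
Proof.
move=> mu_prob; have [m m_prob m_max] := exists_max_b_mass 5 mu_prob.
apply: le_trans (m_max _ mu_prob) _; move: m_max; set B := b_mass m 5 => m_max.
have [m01 m1] := m_prob.
have m0 e : e \in complete_graph X -> 0 <= m e by move/m01/andP => [].
have [e0 e0K] : exists e, e \in complete_graph X.
  have [K0|[e eK]] := set_0Vmem (complete_graph X); last by exists e.
  by move: m1; rewrite K0 big_set0 => /eqP; rewrite eq_sym oner_eq0.
case: (@arg_maxP _ _ _ e0 (mem (complete_graph X)) m e0K) => e eK0 e_max0.
have {eK0} eK : e \in complete_graph X := eK0.
have {e_max0} e_max f : f \in complete_graph X -> m f <= m e := e_max0 f.
have [u [v [uv eE]]] : exists u v, u != v /\ e = [set u; v].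
  by apply/cards2P; move: eK; rewrite inE.
pose M := edge_weight m u v.
have mM a b : a != b -> 0 <= edge_weight m a b <= M.
  move=> ab; have abK : [set a; b] \in complete_graph X by rewrite inE cards2 ab.
  by rewrite /M /edge_weight -eE m0 //=; exact: e_max.
have M_gt0 : 0 < M.
  rewrite ltNge; apply/negP => M0; suff : (1 : R) <= 0 by rewrite ler10.
  rewrite -m1; apply: sumr_le0 => f fK; apply: le_trans M0.
  by rewrite /M /edge_weight -eE; exact: e_max.
have inv5 : (5 ^- 5 : R) = 1 / 3125 by field.
(* The remaining case, to be refuted, has [B > 0], so [B] can be cancelled from the first-order
   conditions. *)
have [//|B_big] := lerP B (5 ^- 5).
have B0 : 0 < B by apply: lt_trans B_big; rewrite inv5; lra.
pose L := \sum_(C in cycle_copies (complete_graph X) 5 | [set u; v] \in C) graph_mass m C.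
(* For a single edge, [#|C :&: S|] is the indicator of [C] passing through it. *)
have L_ge : 5 * B * M <= L.
  have := max_b_mass5_first_order [set e] m_prob m_max.
  rewrite (big_pred1 e) => [|f]; last first.
    by rewrite /= !inE; apply/andb_idl => /eqP ->; rewrite inE in eK.
  move=> h; apply: le_trans (le_trans h _); first by rewrite eE.
  rewrite /L [leRHS]big_mkcondr /=; apply: ler_sum => C CC; rewrite -eE; case: ifPn => eC.
    by rewrite (finset.setIidPr _) ?finset.sub1set // cards1 mulr1.
  by rewrite disjoint_setI0 ?cards0 ?mulr0 // disjoint_sym disjoints1.
have L_leB : L <= B.
  rewrite /L /B /b_mass [leRHS](bigID (fun C : {set {set X}} => [set u; v] \in C)) /= lerDl.
  by apply: sumr_ge0 => C /andP[CC _]; exact: graph_mass_ge0 CC.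
have M5 : M <= 1 / 5.
  by rewrite -(ler_pM2l B0); lra.
(* A 5-cycle meets a star in at most two edges, so the first-order condition bounds [5 * B] times
   the star mass by [2 * B]. *)
have star w : \sum_(f in complete_graph X | w \in f) m f <= 2 / 5.
  have := max_b_mass5_first_order [set f : {set X} | w \in f] m_prob m_max.
  under eq_bigl do rewrite [X in _ && X]inE.
  rewrite -/B => h; rewrite -(ler_pM2l B0).
  suff h2 : \sum_(C in cycle_copies (complete_graph X) 5)
      graph_mass m C * #|C :&: [set f : {set X} | w \in f]|%:R <= B * 2.
    by move: (le_trans h h2); move: (\sum_(_ in _ | _) _) => d; lra.
  rewrite /B /b_mass mulr_suml; apply: ler_sum => C CC.
  apply: ler_wpM2l; first exact: graph_mass_ge0 CC.
  rewrite ler_nat; move: CC; rewrite inE => /andP[_ /(card_cycle5_copy_star w)].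
  by apply: leq_trans; apply/subset_leq_card/fintype.subsetP => f; rewrite !inE.
pose Du := \sum_(x | x \notin [:: v; u]) edge_weight m u x.
pose Dv := \sum_(x | x \notin [:: v; u]) edge_weight m v x.
have Du0 : 0 <= Du.
  apply: sumr_ge0 => x; rewrite !inE negb_or eq_sym => /andP[_ xu].
  by have /andP[] := mM u x ltac:(by rewrite eq_sym).
have Dv0 : 0 <= Dv.
  apply: sumr_ge0 => x; rewrite !inE negb_or => /andP[xv _].
  by have /andP[] := mM v x ltac:(by rewrite eq_sym).
have Du5 : M + Du <= 2 / 5 by rewrite -star_mass_eq.
have Dv5 : M + Dv <= 2 / 5.
  apply: le_trans (star v); rewrite (star_mass_eq _ (_ : v != u)); last by rewrite eq_sym.
  rewrite /M edge_weightC /Dv lerD2l le_eqVlt; apply/orP; left; apply/eqP.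
  by apply: eq_bigl => x; rewrite !inE orbC.
pose C := 1 - M - Du - Dv.
(* [K] does not depend on [x] and [z], so the sum over the end pairs factors as [Du * Dv]. *)
pose K := Num.min (M * C / 2) (M ^+ 2 + (C / 2 - M) ^+ 2).
have K0 : 0 <= K.
  rewrite /K le_min; apply/andP; split.
    by apply: divr_ge0 => //; apply: mulr_ge0; rewrite ?ltW // /C; lra.
  by apply: addr_ge0; exact: sqr_ge0.
have Q_le x z : uniq [:: z; x; v; u] ->
    \sum_(y | y \notin [:: z; x; v; u]) edge_weight m x y * edge_weight m z y <= K.
  move=> un; have := path_mass_le m_prob un; rewrite -/M -/Du -/Dv => massC.
  have sumC : \sum_(y | y \notin [:: z; x; v; u]) (edge_weight m x y + edge_weight m z y) <= C.
    by move: massC; move: (\sum_(_ | _) _) => d; rewrite /C; lra.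
  have hx y : y \notin [:: z; x; v; u] -> 0 <= edge_weight m x y <= M.
    by rewrite !inE !negb_or => /and4P[_ yx _ _]; apply: mM; rewrite eq_sym.
  have hz y : y \notin [:: z; x; v; u] -> 0 <= edge_weight m z y <= M.
    by rewrite !inE !negb_or => /and4P[yz _ _ _]; apply: mM; rewrite eq_sym.
  rewrite /K le_min; apply/andP; split.
    by apply: sum_mul_le_cap => //; exact: ltW.
  exact: sum_mul_le_two.
have K_le : Du * Dv * K <= 1 / 625.
  apply: (@path_product_le _ M); rewrite -?/C ?/K ?ge_min ?lexx ?orbT //; apply/andP; split; lra.
have := le_trans L_ge (sum_mass_through_le u v m0); rewrite -/M.
rewrite [5 * B * M]mulrC ler_pM2l // => le_T.
suff : 5 * B <= 1 / 625 by move: B_big; rewrite inv5 => *; exfalso; lra.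
apply: le_trans le_T (le_trans _ K_le).
(* Extending by 0 to all pairs allows a termwise comparison with the path sum. *)
have -> : Du * Dv = \sum_(p : X * X)
    (if p.1 \notin [:: v; u] then edge_weight m u p.1 else 0) *
    (if p.2 \notin [:: v; u] then edge_weight m v p.2 else 0).
  by rewrite /Du /Dv [X in X * _]big_mkcond [X in _ * X]big_mkcond big_distrlr pair_bigA.
rewrite mulr_suml.
apply: ler_sum => -[x z] _ /=.
have unE y : uniq [:: u; x; y; z; v] = uniq [:: z; x; v; u] && (y \notin [:: z; x; v; u]).
  rewrite andbC -cons_uniq; apply: perm_uniq; apply/permP => P /=; ring.
rewrite (eq_bigl _ _ unE).
(* For a degenerate pair the inner sum is empty and the other side is nonnegative. *)
have [un|nun] := boolP (uniq [:: z; x; v; u]); last first.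
  rewrite big_pred0 // mulr_ge0 // mulr_ge0 //; case: ifPn => //.
    rewrite !inE negb_or => /andP[_ xu].
  by have /andP[] := mM u x ltac:(by rewrite eq_sym).
  rewrite !inE negb_or => /andP[zv _].
  by have /andP[] := mM v z ltac:(by rewrite eq_sym).
rewrite /= -mulr_sumr.
move: (un); rewrite [uniq _]/= andbT => /and3P[zD xD _].
have xD' : x \notin [:: v; u] by [].
have zD' : z \notin [:: v; u] by move: zD; rewrite in_cons negb_or => /andP[].
rewrite xD' zD'; apply: ler_wpM2l; last exact: Q_le.
apply: mulr_ge0.
  move: xD'; rewrite !inE negb_or => /andP[_ xu].
  by have /andP[] := mM u x ltac:(by rewrite eq_sym).
move: zD'; rewrite !inE negb_or => /andP[zv _].
  by have /andP[] := mM v z ltac:(by rewrite eq_sym).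
Qed.

(** * The lower bound and the supremum *)

Lemma cycle_graph5_copy : is_copy (cycle_graph 5) (cycle_graph 5).
Proof.
apply/existsP; exists (finfun id); apply/andP; split.
  by apply/injectiveP => i j; rewrite !ffunE.
rewrite -[X in X == _]imset_id; apply/eqP/eq_in_imset => e _.
by rewrite -[LHS]imset_id; apply: eq_imset => i; rewrite ffunE.
Qed.

Lemma cycle_graph5_subset : cycle_graph 5 \subset complete_graph 'I_5.
Proof.
apply/fintype.subsetP => _ /imsetP[i _ ->]; rewrite inE cards2.
by case: i => [[|[|[|[|[|//]]]]] ?].
Qed.

(** The cycle itself contributes [(1/5) ^+ 5], and every other term is nonnegative. *)
Lemma uniform_cycle_graph5 (R : realType) :
  let mu (e : {set 'I_5}) : R := if e \in cycle_graph 5 then 1 / 5 else 0 in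
  prob_mass mu /\ 5 ^- 5 <= b_mass mu 5.
Proof.
move=> mu; have card5 := card_cycle5_copy cycle_graph5_copy.
have mu01 e : 0 <= mu e <= 1 by rewrite /mu; case: ifP => _; lra.
split; first split => //.
  rewrite -big_mkcondr (eq_bigl (mem (cycle_graph 5))) => [|e].
    by rewrite sumr_const card5 -[LHS]mulr_natr; field.
  by apply: andb_idl; exact: (fintype.subsetP cycle_graph5_subset).
rewrite /b_mass (bigD1 (cycle_graph 5)) /=; last by rewrite inE cycle_graph5_subset cycle_graph5_copy.
rewrite -[leLHS]addr0; apply: lerD.
  rewrite /graph_mass (eq_bigr (fun=> 1 / 5)) => [|e eC]; last by rewrite /mu eC.
  by rewrite prodr_const card5 mul1r exprVn.
by apply: sumr_ge0 => C _; apply: prodr_ge0 => e _; have /andP[] := mu01 e.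
Qed.

Theorem theorem3p4 (R : realType) : b_sup R 5 = 5 ^- 5.
Proof.
have ub (r : R) : (exists (X : finType) (mu : {set X} -> R), prob_mass mu /\ r = b_mass mu 5) ->
    r <= 5 ^- 5.
  by move=> [X [mu [mu_prob ->]]]; exact: b_mass5_le.
have [prob lb] := uniform_cycle_graph5 R.
apply/eqP; rewrite eq_le; apply/andP; split.
  (* The uniform mass also shows that the set is nonempty, so that [sup] does not take its default
     value. *)
  by apply: ge_sup => [|r /ub //]; eexists; do 2 eexists; split; first exact: prob.
apply: le_trans lb _; apply: ub_le_sup; first by exists (5 ^- 5) => r /ub.
by do 2 eexists; split; first exact: prob.
Qed.
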